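(* Let $X$ be a random variable with probability density function $f:[a,b]\to\mathbb{R}_+$ and cumulative distribution function $F(x)=\Pr(X\le x)=\int_a^x f(t)\,dt$, $x\in[a,b]$, and let $E(X)$ be the expectation of $X$. Suppose there exist constants $M,m$ such that $0\le m\le f(t)\le M$ for all $t\in[a,b]$. Then for all $h\in[0,1]$ and all $x$ with $a+h\frac{b-a}{2}\le x\le b-h\frac{b-a}{2}$, the following three inequalities hold: $$\left|(b-a)\left\{\left[\Pr(X\le x)-\frac{M+m}{2}\left(x-\frac{a+b}{2}\right)\right](1-h)+\frac12 h\right\}-(b-E(X))\right|\le\frac12\left[\frac{(b-a)^2}{4}\left[h^2+(h-1)^2\right]+\left(x-\frac{a+b}{2}\right)^2\right](M-m),$$ $$\left|(b-a)\left\{\left[\Pr(X\le x)-m\left(x-\frac{a+b}{2}\right)\right](1-h)+\frac12 h\right\}-(b-E(X))\right|\le(b-a)\max\left\{h\frac{b-a}{2},\,x-a-h\frac{b-a}{2},\,b-x-h\frac{b-a}{2}\right\}\left(\frac1{b-a}-m\right),$$ and $$\left|(b-a)\left\{\left[\Pr(X\le x)-M\left(x-\frac{a+b}{2}\right)\right](1-h)+\frac12 h\right\}-(b-E(X))\right|\le(b-a)\max\left\{h\frac{b-a}{2},\,x-a-h\frac{b-a}{2},\,b-x-h\frac{b-a}{2}\right\}\left(M-\frac1{b-a}\right).$$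
   Context: Here $a<b$ are real numbers, $\mathbb{R}_+$ denotes the nonnegative reals, and $X$ takes values in $[a,b]$, so that $F(a)=0$ and $F(b)=1$. *)

(* Defs.v *)
From HB Require Import structures.
From mathcomp Require Import all_boot all_order all_algebra.
From mathcomp Require Import all_classical all_reals all_analysis.
Set Implicit Arguments.
Unset Strict Implicit.
Unset Printing Implicit Defensive.
Import Order.TTheory GRing.Theory Num.Theory.

Local Open Scope classical_set_scope.
Local Open Scope ring_scope.

(* Only the restriction of [f] to `[a, b] matters.  At x = b the last clause,
   together with the second one, forces [f] to have total mass 1. *)
Definition has_pdf_on (d : measure_display) (T : measurableType d)
    (R : realType) (P : probability T R) (X : {RV P >-> R}) (a b : R)
    (f : R -> R) : Prop :=
  [/\ measurable_fun `[a, b] f,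
      {ae P, forall w, a <= X w <= b},
      forall t : R, a <= t <= b -> 0 <= f t &
      forall x : R, a <= x <= b ->
        cdf X x = (\int[lebesgue_measure]_(t in `[a, x]) (f t)%:E)%E].

(* Main.v *)
(* Put p = a + h (b - a) / 2, q = b - h (b - a) / 2, and let K(t) = t - p on
   [a, x], K(t) = t - q on ]x, b].  Montgomery's identity, together with
   E[b - X] = \int_a^b (b - t) f(t) dt, shows that for every constant c the
   quantity
     (b - a) {[Pr(X <= x) - c (x - (a + b) / 2)] (1 - h) + h / 2} - (b - E(X))
   equals \int_a^b K(t) (f(t) - c) dt.  For c = (M + m) / 2 use
   |f - c| <= (M - m) / 2 and compute \int |K|; for c = m and c = M the factor
   f - c has a constant sign, so use sup |K| and compute \int |f - c|. *)
Require Import Defs.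
From HB Require Import structures.
From mathcomp Require Import all_boot all_order all_algebra.
From mathcomp Require Import all_classical all_reals all_analysis.
From mathcomp Require Import measurable_realfun.
From mathcomp Require Import ring lra.
Import Order.TTheory GRing.Theory Num.Theory.
Import numFieldNormedType.Exports.

Local Open Scope classical_set_scope.
Local Open Scope ring_scope.

(** * Layer-cake formula by Tonelli *)

(* Applied twice: with w = 1 and g = X this integrates the cdf of X; with w = f
   cut off outside [a, b] and g = id it integrates x |-> \int_a^x f. *)
Lemma layer_cake_itv (d : measure_display) (T : measurableType d)
    (R : realType) (mu : {sigma_finite_measure set T -> \bar R})
    (g w : T -> R) (a b : R) :
  measurable_fun setT g -> measurable_fun setT w -> (forall t, 0 <= w t) ->
  {ae mu, forall t, w t != 0 -> a <= g t <= b} ->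
  (\int[mu]_t (w t * (b - g t))%:E =
   \int[lebesgue_measure]_(s in `[a, b])
     \int[mu]_(t in [set t | (g t <= s)%R]) (w t)%:E)%E.
Proof.
move=> mg mw w0 gab.
pose GR := measurableTypeR R.
pose S : set (T * GR) := [set p | g p.1 <= p.2] `&` [set p | p.2 \in `[a, b]].
have mS : measurable S.
  apply: measurableI.
    rewrite -[X in measurable X]setTI.
    apply: measurable_fun_le => //.
    exact: measurableT_comp.
  have := @measurable_snd _ _ T GR measurableT `[a, b]%classic.
  by rewrite setTI; apply.
(* The integral of [k] over s first gives w(t) times the length b - g(t) of [[g t, b]]; over t first
   it gives the mass of w on the sublevel set of g. *)
pose k (p : T * GR) : \bar R := (w p.1 * \1_S p)%:E.
have mk : measurable_fun setT k.
  apply/measurable_EFinP/measurable_funM; first exact: measurableT_comp.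
  exact: measurable_indic.
have k0 p : (0 <= k p)%E by rewrite lee_fin mulr_ge0.
transitivity (\int[mu]_t \int[lebesgue_measure]_s k (t, s))%E; last first.
  rewrite (fubini_tonelli k mk k0).
  rewrite [RHS]integral_mkcond; apply: eq_integral => s _.
  rewrite patchE mem_setE; case: ifPn => sab; last first.
    apply: integral0_eq => t _; rewrite /k indicE memNset ?mulr0//= => -[_ /=].
    exact/negP.
  rewrite [RHS]integral_mkcond; apply: eq_integral => t _.
  rewrite patchE /k indicE; case: ifPn => [/set_mem/= ts|/negP ts].
    by rewrite mem_set ?mulr1.
  by rewrite memNset ?mulr0// => -[/= ts' _]; apply: ts; rewrite inE.
apply: ae_eq_integral => //.
- apply/measurable_EFinP/measurable_funM; first by [].
  by apply: measurable_funB.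
- exact: measurable_fun_fubini_tonelli_F.
apply: filterS gab => t gab _ /=.
(* Where w vanishes, g need not lie in [[a, b]], but then both integrands are zero. *)
have [wt0|/gab/andP[ag gb]] := eqVneq (w t) 0.
  by rewrite wt0 mul0r integral0_eq// => s _; rewrite /k/= wt0 mul0r.
transitivity (\int[lebesgue_measure]_(s in `[g t, b]) (w t)%:E)%E.
  rewrite integral_cst//= lebesgue_measure_itv/= lte_fin.
  have [_|bg] := ltP (g t) b; first by rewrite -EFinD -EFinM.
  by rewrite (@le_anti _ _ b (g t)) ?bg// subrr mulr0 mule0.
rewrite integral_mkcond; apply: eq_integral => s _.
rewrite patchE /k indicE mem_setE in_itv/=.
case: ifPn => [/andP[gs sb]|gsb].
  by rewrite mem_set ?mulr1//; split => //=; rewrite in_itv/= sb (le_trans ag).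
rewrite memNset ?mulr0// => -[/= gs]; rewrite in_itv/= => /andP[_ sb].
by rewrite gs sb in gsb.
Qed.

(** * Integrals of linear kernels over intervals *)

Section interval_integrals.
Context {R : realType}.
Local Notation mu := (@lebesgue_measure R).

Lemma integrable_cst_itv (u v c : R) : mu.-integrable `[u, v] (EFin \o cst c).
Proof.
apply: measurable_bounded_integrable => //; last exact: bounded_cst.
by rewrite /= lebesgue_measure_itv/=; case: ifPn => // _; rewrite -EFinB ltry.
Qed.

Lemma bounded_subr_itv (u v p : R) : [bounded t - p | t in `[u, v]].
Proof.
exists (`|u - p| + `|v - p|); split; first by rewrite num_real.
move=> K uvK t; rewrite /= in_itv/= => /andP[ut tv].
rewrite (le_trans _ (ltW uvK))// ler_norml; apply/andP; split.
  have := ler_norm (- (u - p)); have := normr_ge0 (v - p).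
  by rewrite normrN; lra.
by have := ler_norm (v - p); have := normr_ge0 (u - p); lra.
Qed.

Lemma integrable_subrM (u v p : R) (g : R -> R) :
  mu.-integrable `[u, v] (EFin \o g) ->
  mu.-integrable `[u, v] (EFin \o (fun t => (t - p) * g t)).
Proof.
move=> ig.
have := @integrableMr _ _ _ mu `[u, v]%classic _ (fun t => t - p) _ _ _ ig.
apply => //; last exact: bounded_subr_itv.
exact: measurable_funB.
Qed.

Lemma integrableZl_EFin (u v c : R) (g : R -> R) :
  mu.-integrable `[u, v] (EFin \o g) ->
  mu.-integrable `[u, v] (EFin \o (fun t => c * g t)).
Proof.
by move=> ig; apply: (@integrableZl _ _ _ mu `[u, v]%classic _ c _ ig).
Qed.

Lemma integrable_subr (u v p : R) :
  mu.-integrable `[u, v] (EFin \o (fun t : R => t - p)).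
Proof.
have := integrable_subrM u v p (cst 1) (integrable_cst_itv u v 1).
by apply: eq_integrable => // t _ /=; rewrite mulr1.
Qed.

(** Serves the case c = M: it moves the sign inside, so that bounds for nonnegative weights apply to
    M - f. *)
Lemma Rintegral_subrMN1 (u v p : R) (g : R -> R) :
  mu.-integrable `[u, v] (EFin \o g) ->
  \int[mu]_(t in `[u, v]) ((t - p) * (- 1 * g t)) =
  - \int[mu]_(t in `[u, v]) ((t - p) * g t).
Proof.
move=> ig; transitivity (\int[mu]_(t in `[u, v]) ((-1) * ((t - p) * g t))).
  by apply: eq_Rintegral => t _; ring.
by rewrite RintegralZl ?mulN1r//; exact: integrable_subrM.
Qed.

Lemma Rintegral_subr (u v p : R) : u <= v ->
  \int[mu]_(t in `[u, v]) (t - p) = ((v - p) ^+ 2 - (u - p) ^+ 2) / 2.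
Proof.
(* The fundamental theorem is applied only for u < v; the one-point interval is treated apart. *)
rewrite le_eqVlt => /predU1P[<-|uv].
  by rewrite set_itv1 Rintegral_set1 subrr mul0r.
pose F (t : R) : R := (t - p) ^+ 2 / 2.
have dF (t : R) : is_derive t (1 : R) F (t - p).
  by apply: is_derive_eq; rewrite /GRing.scale/= mulr0; lra.
have FTC : (\int[mu]_(t in `[u, v]) (t - p)%:E = (F v)%:E - (F u)%:E)%E.
  apply: continuous_FTC2 => //.
  - by apply: continuous_subspaceT => r; apply: cvgB => //; exact: cvg_cst.
  - have cF t : {for t, continuous F}.
      apply: differentiable_continuous; apply/derivable1_diffP.
      exact: ex_derive.
    split => [t _| |]; first exact: ex_derive.
      exact/cvg_at_right_filter/cF.
    exact/cvg_at_left_filter/cF.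
  - by move=> t _; rewrite derive1E derive_val.
by rewrite /Rintegral FTC /F/= mulrBl.
Qed.

(** Both pieces are closed: x is counted twice, harmlessly, since a point is Lebesgue-null. *)
Lemma Rintegral_itv_split (a x b : R) (g : R -> R) :
  mu.-integrable `[a, b] (EFin \o g) -> a <= x <= b ->
  \int[mu]_(t in `[a, b]) g t =
  \int[mu]_(t in `[a, x]) g t + \int[mu]_(t in `[x, b]) g t.
Proof.
move=> ig /andP[ax xb]; apply/eqP; rewrite addrC -subr_eq; apply/eqP.
rewrite Rintegral_itvB ?bnd_simp// Rintegral_itv_obnd_cbnd//.
by apply: integrableS ig => //; apply: subset_itv; rewrite bnd_simp.
Qed.

Lemma integrable_subitv (a b u v : R) (g : R -> R) :
  mu.-integrable `[a, b] (EFin \o g) -> a <= u -> v <= b ->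
  mu.-integrable `[u, v] (EFin \o g).
Proof.
move=> ig au vb; apply: integrableS ig => //.
by apply: subset_itv; rewrite bnd_simp.
Qed.

(** Split at p, where t - p changes sign. *)
Lemma Rintegral_normr_subr (u v p : R) : u <= p <= v ->
  \int[mu]_(t in `[u, v]) `|t - p| = ((p - u) ^+ 2 + (v - p) ^+ 2) / 2.
Proof.
move=> upv; have /andP[up pv] := upv.
rewrite (Rintegral_itv_split u p v _ _ upv); last first.
  exact: (integrable_norm (integrable_subr u v p)).
rewrite [X in X + _](_ : _ = (p - u) ^+ 2 / 2); last first.
  transitivity (\int[mu]_(t in `[u, p]) ((-1) * (t - p))).
    apply: eq_Rintegral => t; rewrite inE/= in_itv/= => /andP[_ tp].
    by rewrite ler0_norm ?subr_le0// mulN1r.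
  by rewrite RintegralZl ?Rintegral_subr//; [field|exact: integrable_subr].
rewrite [X in _ + X](_ : _ = (v - p) ^+ 2 / 2); first by rewrite mulrDl.
transitivity (\int[mu]_(t in `[p, v]) (t - p)).
  apply: eq_Rintegral => t; rewrite inE/= in_itv/= => /andP[pt _].
  by rewrite ger0_norm ?subr_ge0.
by rewrite Rintegral_subr//; field.
Qed.

Lemma normr_Rintegral_subrM_le_cst (u v p c : R) (g : R -> R) :
  u <= p <= v -> mu.-integrable `[u, v] (EFin \o g) ->
  (forall t, u <= t <= v -> `|g t| <= c) ->
  `|\int[mu]_(t in `[u, v]) ((t - p) * g t)| <=
  c * (((p - u) ^+ 2 + (v - p) ^+ 2) / 2).
Proof.
move=> upv ig gc.
apply: (le_trans (le_normr_Rintegral _ (integrable_subrM u v p g ig))) => //.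
have iN := integrable_norm (integrable_subr u v p).
rewrite -Rintegral_normr_subr// -RintegralZl//.
apply: le_Rintegral => //.
- exact: (integrable_norm (integrable_subrM u v p g ig)).
- exact: integrableZl_EFin.
move=> t; rewrite /= in_itv/= => /gc gtc.
by rewrite normrM mulrC ler_wpM2r.
Qed.

(** On [[u, v]] the factor t - p lies between u - p and v - p, hence |t - p| <= c; since g >= 0, the
    integral of g itself remains. *)
Lemma normr_Rintegral_subrM_le (u v p c : R) (g : R -> R) :
  u - p <= c -> v - p <= c -> p - u <= c ->
  mu.-integrable `[u, v] (EFin \o g) ->
  (forall t, u <= t <= v -> 0 <= g t) ->
  `|\int[mu]_(t in `[u, v]) ((t - p) * g t)| <=
  c * \int[mu]_(t in `[u, v]) g t.
Proof.
move=> upc vpc puc ig g0.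
apply: (le_trans (le_normr_Rintegral _ (integrable_subrM u v p g ig))) => //.
rewrite -RintegralZl//; apply: le_Rintegral => //.
- exact: (integrable_norm (integrable_subrM u v p g ig)).
- exact: integrableZl_EFin.
move=> t; rewrite /= in_itv/= => uv.
have /andP[ut tv] := uv.
rewrite normrM (ger0_norm (g0 _ uv)) ler_wpM2r ?g0// ler_norml.
by apply/andP; split; lra.
Qed.

(** No integration by parts: write t - p = (b - p) + (t - b) on the left piece and t - q = (b - q) +
    (t - b) on the right one, then regroup. The three terms are shaped to become the cdf, the total
    mass and the expectation. *)
Lemma montgomery_identity (a b p q x : R) (g : R -> R) :
  a <= x <= b -> mu.-integrable `[a, b] (EFin \o g) ->
  \int[mu]_(t in `[a, x]) ((t - p) * g t) +
  \int[mu]_(t in `[x, b]) ((t - q) * g t) =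
  (q - p) * \int[mu]_(t in `[a, x]) g t + (b - q) * \int[mu]_(t in `[a, b]) g t
  + \int[mu]_(t in `[a, b]) ((t - b) * g t).
Proof.
move=> axb ig; have /andP[ax xb] := axb.
have shift u v r : a <= u -> v <= b ->
    \int[mu]_(t in `[u, v]) ((t - r) * g t) =
    (b - r) * \int[mu]_(t in `[u, v]) g t
    + \int[mu]_(t in `[u, v]) ((t - b) * g t).
  move=> au vb; have igu := integrable_subitv a b u v g ig au vb.
  rewrite -RintegralZl// -RintegralD//.
  - by apply: eq_Rintegral => t _; ring.
  - exact: integrableZl_EFin.
  - exact: integrable_subrM.
rewrite (shift a x p)// (shift x b q)// (Rintegral_itv_split a x b g)//.
rewrite (Rintegral_itv_split a x b (fun t => (t - b) * g t))//; first by ring.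
exact: integrable_subrM.
Qed.

End interval_integrals.

(** * Cdf, total mass and expectation in terms of the density *)

Section pdf_on_interval.
Context {d : measure_display} {T : measurableType d} {R : realType}
  {P : probability T R}.
Local Notation mu := (@lebesgue_measure R).

Lemma ae_bounded_integrable (X : {RV P >-> R}) (a b : R) :
  {ae P, forall w, a <= X w <= b} -> P.-integrable setT (EFin \o X).
Proof.
move=> Xab; apply/integrableP; split; first exact/measurable_EFinP.
apply: (@le_lt_trans _ _ ((`|a| + `|b|)%:E * P setT)%E).
  apply: integral_le_bound => //; first exact/measurable_EFinP.
  apply: filterS Xab => w /andP[aX Xb] _ /=.
  rewrite lee_fin ler_norml; apply/andP; split.
    by have := ler_norm (- a); have := normr_ge0 b; rewrite normrN; lra.
  by have := ler_norm b; have := normr_ge0 a; lra.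
by rewrite probability_setT mule1 ltry.
Qed.

(** Both sides equal the integral of the cdf over [[a, b]], by two uses of the layer-cake formula;
    thus a density known only through the cdf suffices, without integrating against the law of X. *)
Lemma expectation_pdf_on (X : {RV P >-> R}) (a b : R) (f : R -> R) :
  has_pdf_on X a b f ->
  (\int[P]_w (b - X w)%:E = \int[mu]_(t in `[a, b]) (f t * (b - t))%:E)%E.
Proof.
move=> [mf Xab f0 FE].
have /= E1 := @layer_cake_itv _ _ _ P X (cst 1) a b.
under eq_integral do rewrite -[(b - X _)%R]mul1r.
rewrite E1//; last by apply: filterS Xab => w + _.
(* The layer-cake weight must be nonnegative and measurable everywhere, whereas f is controlled only
   on [[a, b]]. *)
pose f' := f \_ `[a, b].
transitivity (\int[mu]_t (f' t * (b - t))%:E)%E; last first.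
  rewrite [RHS]integral_mkcond; apply: eq_integral => t _.
  by rewrite /f' !patchE; case: ifPn => // _; rewrite mul0r.
rewrite (@layer_cake_itv _ _ _ mu id f' a b)//; last 3 first.
- exact/(measurable_restrictT _ _).1.
- move=> t; rewrite /f' patchE; case: ifPn => //; rewrite inE/= in_itv/=.
  exact: f0.
- apply: aeW => t; rewrite /f' patchE; case: ifPn => [|_]; last by rewrite eqxx.
  by rewrite inE/= in_itv.
apply: eq_integral => s; rewrite inE/= in_itv/= => /andP[as_ sb].
transitivity (cdf X s).
  rewrite (_ : [set t | _] = X @^-1` `]-oo, s]); last by rewrite set_itvNyc.
  by rewrite integral_cst ?mul1e//; exact: measurable_funPTI.
(* As s <= b, cutting []-oo, s]] down to the support of [f'] leaves [[a, s]]. *)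
rewrite FE ?as_// [LHS]integral_mkcond [RHS]integral_mkcond.
apply: eq_integral => t _; rewrite /f' !patchE.
case: ifPn => [/set_mem/=|/negP/[!inE]/= atsN].
  rewrite in_itv/= => /andP[at_ ts].
  by rewrite !mem_set//= in_itv/= at_ (le_trans ts sb).
case: ifPn => // /set_mem/= ts; rewrite memNset//= in_itv/= => /andP[at_ _].
by apply: atsN; rewrite in_itv/= at_ ts.
Qed.

Lemma cdf_pdf_on (X : {RV P >-> R}) (a b x : R) (f : R -> R) :
  has_pdf_on X a b f -> a <= x <= b ->
  fine (cdf X x) = \int[mu]_(t in `[a, x]) f t.
Proof. by move=> [_ _ _ FE] axb; rewrite FE. Qed.

(** The integral is the cdf at b, and X exceeds b with probability zero. *)
Lemma Rintegral_pdf_on (X : {RV P >-> R}) (a b : R) (f : R -> R) :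
  a <= b -> has_pdf_on X a b f -> \int[mu]_(t in `[a, b]) f t = 1.
Proof.
move=> ab hf; rewrite -(cdf_pdf_on X a b _ f hf) ?ab ?lexx//.
case: hf => _ Xab _ _.
have mA : measurable (X @^-1` `]-oo, b]) by exact: measurable_funPTI.
suff PAC : P (~` (X @^-1` `]-oo, b])) = 0%E.
  have := probability_setC P (measurableC mA).
  by rewrite setCK PAC sube0 /cdf /distribution /pushforward => ->.
apply/(negligibleP _ (measurableC mA)).
apply: negligibleS Xab => w /= /negP; rewrite in_itv/= -ltNge => bX /andP[_].
by rewrite leNgt bX.
Qed.

(** As f >= 0, its absolute integral is the cdf at b, which is at most 1. *)
Lemma integrable_pdf_on (X : {RV P >-> R}) (a b : R) (f : R -> R) :
  a <= b -> has_pdf_on X a b f -> mu.-integrable `[a, b] (EFin \o f).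
Proof.
move=> ab [mf _ f0 FE]; apply/integrableP; split; first exact/measurable_EFinP.
apply: le_lt_trans (ltry 1); apply: le_trans (cdf_le1 X b).
rewrite FE ?ab ?lexx// le_eqVlt; apply/orP; left; apply/eqP.
apply: eq_integral => t; rewrite inE/= in_itv/= => /f0 ft0.
by rewrite ger0_norm.
Qed.

Lemma expectation_Rintegral_pdf_on (X : {RV P >-> R}) (a b : R) (f : R -> R) :
  a <= b -> has_pdf_on X a b f ->
  b - fine 'E_P[X] = - \int[mu]_(t in `[a, b]) ((t - b) * f t).
Proof.
move=> ab hf; have iX : P.-integrable setT (EFin \o X).
  by case: hf => _ /ae_bounded_integrable.
have := expectation_pdf_on X a b f hf.
rewrite integralB_EFin//; last exact: finite_measure_integrable_cst.
have -> : (\int[P]_w b%:E = b%:E)%E.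
  by rewrite integral_cst// [X in (_ * X)%E](probability_setT P) mule1.
rewrite -expectation_def => /(congr1 fine).
rewrite fineB//= ?expectation_fin_num//; last exact/Lfun1_integrable.
move=> ->.
transitivity (\int[mu]_(t in `[a, b]) ((-1) * ((t - b) * f t))).
  by apply: eq_Rintegral => t _; ring.
rewrite RintegralZl ?mulN1r//; apply: integrable_subrM.
exact: integrable_pdf_on ab hf.
Qed.

(** Montgomery's identity for g = f - c, where q - p = (1 - h)(b - a) and b - q = h (b - a) / 2. The
    terms in c add up to -c (b - a)(1 - h)(x - (a + b) / 2). *)
Lemma pdf_on_montgomery (X : {RV P >-> R}) (a b h x c : R) (f : R -> R) :
  a <= x <= b -> has_pdf_on X a b f ->
  (b - a) * ((fine (cdf X x) - c * (x - (a + b) / 2)) * (1 - h) + 1 / 2 * h)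
    - (b - fine 'E_P[X])
  = \int[mu]_(t in `[a, x]) ((t - (a + h * ((b - a) / 2))) * (f t - c))
    + \int[mu]_(t in `[x, b]) ((t - (b - h * ((b - a) / 2))) * (f t - c)).
Proof.
move=> axb hf; have /andP[ax xb] := axb; have ab := le_trans ax xb.
have intf := integrable_pdf_on X a b f ab hf.
have intc u v := integrable_cst_itv u v c.
have intfc : mu.-integrable `[a, b] (EFin \o (fun t => f t - c)).
  have := integrableB _ intf (intc a b); exact.
rewrite (montgomery_identity a b _ _ x (fun t => f t - c))//.
have intfx := integrable_subitv a b a x f intf (lexx a) xb.
rewrite (RintegralB _ intfx (intc a x))// (RintegralB _ intf (intc a b))//.
rewrite -(cdf_pdf_on X a b _ f hf)// (Rintegral_pdf_on X a b f ab hf).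
rewrite (expectation_Rintegral_pdf_on X a b f ab hf).
have -> : \int[mu]_(t in `[a, b]) ((t - b) * (f t - c)) =
    \int[mu]_(t in `[a, b]) ((t - b) * f t) + c * (b - a) ^+ 2 / 2.
  under eq_Rintegral do rewrite mulrBr.
  have intbf := integrable_subrM a b b f intf.
  have intb := integrable_subr a b b.
  rewrite RintegralB//; last exact: integrable_subrM.
  by rewrite RintegralZr// Rintegral_subr//; field.
have cstE u v : u <= v -> \int[mu]_(_ in `[u, v]) c = c * (v - u).
  rewrite le_eqVlt => /predU1P[->|uv].
    by rewrite set_itv1 Rintegral_set1 subrr mulr0.
  by rewrite Rintegral_cst//= lebesgue_measure_itv/= lte_fin uv.
by rewrite /cst !cstE//; field.
Qed.

End pdf_on_interval.

(** * The three inequalities *)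

Theorem theorem10 (d : measure_display) (T : measurableType d) (R : realType)
    (P : probability T R) (X : {RV P >-> R}) (a b : R) (f : R -> R)
    (M m : R) (hab : a < b) (hf : has_pdf_on X a b f)
    (hm : 0 <= m) (hmM : forall t : R, a <= t <= b -> m <= f t <= M)
    (h x : R) (hh : 0 <= h <= 1)
    (hx : a + h * ((b - a) / 2) <= x <= b - h * ((b - a) / 2)) :
  [/\ `| (b - a) * ((fine (cdf X x) - (M + m) / 2 * (x - (a + b) / 2)) * (1 - h)
                    + 1 / 2 * h)
         - (b - fine 'E_P[X]) |
      <= 1 / 2 * ((b - a) ^+ 2 / 4 * (h ^+ 2 + (h - 1) ^+ 2)
                  + (x - (a + b) / 2) ^+ 2) * (M - m),
      `| (b - a) * ((fine (cdf X x) - m * (x - (a + b) / 2)) * (1 - h)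
                    + 1 / 2 * h)
         - (b - fine 'E_P[X]) |
      <= (b - a)
         * Num.max (h * ((b - a) / 2))
             (Num.max (x - a - h * ((b - a) / 2)) (b - x - h * ((b - a) / 2)))
         * (1 / (b - a) - m)
    & `| (b - a) * ((fine (cdf X x) - M * (x - (a + b) / 2)) * (1 - h)
                    + 1 / 2 * h)
         - (b - fine 'E_P[X]) |
      <= (b - a)
         * Num.max (h * ((b - a) / 2))
             (Num.max (x - a - h * ((b - a) / 2)) (b - x - h * ((b - a) / 2)))
         * (M - 1 / (b - a))].
Proof.
have /andP[h0 h1] := hh; have /andP[px xq] := hx.
have hL0 : 0 <= h * ((b - a) / 2) by rewrite mulr_ge0// divr_ge0 ?subr_ge0 ?ltW.
have hL1 : h * ((b - a) / 2) <= (b - a) / 2.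
  by rewrite ler_piMl// divr_ge0 ?subr_ge0 ?ltW.
have ax : a <= x by lra.
have xb : x <= b by lra.
have axb : a <= x <= b by rewrite ax.
have ab := ltW hab.
have intf := integrable_pdf_on X a b f ab hf.
have intB c :
    lebesgue_measure.-integrable `[a, b] (EFin \o (fun t => f t - c)).
  have := integrableB _ intf (integrable_cst_itv a b c); exact.
have intfB c : \int[lebesgue_measure]_(t in `[a, b]) (f t - c) =
    1 - c * (b - a).
  rewrite (RintegralB _ intf (integrable_cst_itv a b c))//.
  rewrite (Rintegral_pdf_on X a b f ab hf) /cst Rintegral_cst//=.
  by rewrite lebesgue_measure_itv/= lte_fin hab.
(* [C] is sup |K|: on each piece |K| is largest at an endpoint, with values h (b - a) / 2 at a and
   b, and x - p, q - x on the two sides of x. *)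
set C := Num.max _ _.
have C1 : h * ((b - a) / 2) <= C by rewrite le_max lexx.
have C2 : x - a - h * ((b - a) / 2) <= C by rewrite !le_max lexx orbT.
have C3 : b - x - h * ((b - a) / 2) <= C by rewrite !le_max lexx !orbT.
have Lneq0 : b - a != 0 by rewrite subr_eq0 gt_eqF.
have kernel_le (g : R -> R) :
    lebesgue_measure.-integrable `[a, b] (EFin \o g) ->
    (forall t, a <= t <= b -> 0 <= g t) ->
    `|\int[lebesgue_measure]_(t in `[a, x])
         ((t - (a + h * ((b - a) / 2))) * g t)
      + \int[lebesgue_measure]_(t in `[x, b])
         ((t - (b - h * ((b - a) / 2))) * g t)|
    <= C * \int[lebesgue_measure]_(t in `[a, b]) g t.
  move=> ig g0; rewrite (Rintegral_itv_split a x b g)// mulrDr.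
  apply: (le_trans (ler_normD _ _)); apply: lerD.
    apply: normr_Rintegral_subrM_le; [lra|lra|lra| |].
      exact: integrable_subitv ig _ _.
    by move=> t /andP[at_ tx]; rewrite g0// at_ (le_trans tx).
  apply: normr_Rintegral_subrM_le; [lra|lra|lra| |].
    exact: integrable_subitv ig _ _.
  by move=> t /andP[xt tb]; rewrite g0// tb (le_trans ax).
split; rewrite (pdf_on_montgomery X a b h x _ f axb hf).
(* Case c = (M + m) / 2: the midpoint of [[m, M]] is within (M - m) / 2 of f. *)
- have fM u v t : a <= u -> v <= b -> u <= t <= v ->
      `|f t - (M + m) / 2| <= (M - m) / 2.
    move=> au vb /andP[ut tv].
    have /andP[mft ftM] : m <= f t <= M.
      by apply: hmM; rewrite (le_trans au ut) (le_trans tv vb).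
    by rewrite ler_norml; apply/andP; split; lra.
  have half_le u v p : a <= u -> v <= b -> u <= p <= v ->
      `|\int[lebesgue_measure]_(t in `[u, v])
          ((t - p) * (f t - (M + m) / 2))|
      <= (M - m) / 2 * (((p - u) ^+ 2 + (v - p) ^+ 2) / 2).
    move=> au vb upv; apply: normr_Rintegral_subrM_le_cst => //.
      exact: integrable_subitv (intB _) _ _.
    by move=> t; exact: fM.
  apply: (le_trans (ler_normD _ _)).
  apply: (le_trans (lerD (half_le _ _ _ _ _ _) (half_le _ _ _ _ _ _))) => //.
  + by apply/andP; split; lra.
  + by apply/andP; split; lra.
  (* The bounds agree exactly: with y = x - (a + b) / 2 and r = (1 - h)(b - a) / 2, x - p = r + y
     and q - x = r - y, so their squares sum to 2 r^2 + 2 y^2. *)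
  by rewrite le_eqVlt; apply/orP; left; apply/eqP; field.
- apply: (le_trans (kernel_le _ (intB m) _)).
    by move=> t /hmM /andP[mft _]; rewrite subr_ge0.
  (* Again an equality: f - m has integral 1 - m (b - a) = (b - a)(1 / (b - a) - m). *)
  by rewrite intfB le_eqVlt; apply/orP; left; apply/eqP; field.
- have intN : lebesgue_measure.-integrable `[a, b]
      (EFin \o (fun t => - 1 * (f t - M))).
    exact: integrableZl_EFin.
  (* Since f - M <= 0, change the sign under the absolute value and use the kernel bound with M -
     f. *)
  rewrite -normrN opprD.
  rewrite -!Rintegral_subrMN1; [|exact: integrable_subitv (intB _) _ _..].
  apply: (le_trans (kernel_le _ intN _)).
    by move=> t /hmM /andP[_ ftM]; lra.
  rewrite RintegralZl// intfB.
  by rewrite le_eqVlt; apply/orP; left; apply/eqP; field.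
Qed.
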